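(* Let $\Omega_c$ be a commutative semigroup and let $(A,\prec_\omega,\succ_\omega,\Omega_c)$ be a pre-anti-flexible family algebra. For all $x,y\in A$ and $\alpha,\beta\in\Omega_c$ put $x\ast_{\alpha,\beta}y = x\succ_\alpha y + x\prec_\beta y$ and define $$[x,y]_{\alpha,\beta} = x\ast_{\alpha,\beta}y - y\ast_{\beta,\alpha}x = (x\succ_\alpha y + x\prec_\beta y) - (y\succ_\beta x + y\prec_\alpha x).$$ Then $(A,[\cdot,\cdot]_{\alpha,\beta},\Omega_c)$ is an $\Omega_c$-relative Lie algebra.
   Context: Standing conventions: $\Omega_c$ is a commutative associative semigroup; $A$ is a finite-dimensional vector space over a field of characteristic zero; all operations on $A$ are bilinear. A pre-anti-flexible family algebra $(A,\prec_\omega,\succ_\omega,\Omega_c)$ is a vector space $A$ with bilinear operations $\prec_\alpha,\succ_\alpha:A\times A\to A$ for each $\alpha\in\Omega_c$ such that for all $x,y,z\in A$ and $\alpha,\beta\in\Omega_c$: $$(x\succ_\alpha y)\prec_\beta z - x\succ_\alpha(y\prec_\beta z) = (z\succ_\beta y)\prec_\alpha x - z\succ_\beta(y\prec_\alpha x),$$ $$(x\succ_\alpha y + x\prec_\beta y)\succ_{\alpha\beta}z - x\succ_\alpha(y\succ_\beta z) = (z\prec_\beta y)\prec_\alpha x - z\prec_{\beta\alpha}(y\succ_\beta x + y\prec_\alpha x).$$ An $\Omega_c$-relative Lie algebra is a vector space $A$ with a bilinear operation $[\cdot,\cdot]_{\alpha,\beta}$ for each pair $(\alpha,\beta)\in\Omega_c^2$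 such that for all $x,y,z\in A$ and $\alpha,\beta,\gamma\in\Omega_c$: $$[x,y]_{\alpha,\beta}+[y,x]_{\beta,\alpha}=0,$$ $$[[x,y]_{\alpha,\beta},z]_{\alpha\beta,\gamma}+[[y,z]_{\beta,\gamma},x]_{\beta\gamma,\alpha}+[[z,x]_{\gamma,\alpha},y]_{\gamma\alpha,\beta}=0.$$ *)

(* Defs.v *)
From mathcomp Require Import all_boot all_algebra.

Set Implicit Arguments.
Unset Strict Implicit.
Unset Printing Implicit Defensive.

Import GRing.Theory.
Local Open Scope ring_scope.

Section FamilyAlgebras.

Variables (Omega : Type) (mul : SemiGroup.com_law Omega).
Variables (K : fieldType) (A : lmodType K).

Implicit Types (prec succ : Omega -> A -> A -> A).
Implicit Types (br : Omega -> Omega -> A -> A -> A).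

(* [prec a x y] is x ≺_a y and [succ a x y] is x ≻_a y. *)
Record pre_anti_flexible_family_algebra prec succ : Prop :=
  PreAntiFlexibleFamilyAlgebra {
  paf_bilinear_prec : forall a, bilinear_for *:%R *:%R (prec a);
  paf_bilinear_succ : forall a, bilinear_for *:%R *:%R (succ a);
  paf_succ_prec : forall x y z a b,
    prec b (succ a x y) z - succ a x (prec b y z)
    = prec a (succ b z y) x - succ b z (prec a y x);
  paf_succ_succ : forall x y z a b,
    succ (mul a b) (succ a x y + prec b x y) z - succ a x (succ b y z)
    = prec a (prec b z y) x - prec (mul b a) z (succ b y x + prec a y x)
}.

(* [br a b x y] is [x, y]_{a,b}. *)
Record relative_Lie_algebra br : Prop := RelativeLieAlgebra {
  rLie_bilinear : forall a b, bilinear_for *:%R *:%R (br a b);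
  rLie_antisym : forall x y a b, br a b x y + br b a y x = 0;
  rLie_Jacobi : forall x y z a b c,
    br (mul a b) c (br a b x y) z
    + br (mul b c) a (br b c y z) x
    + br (mul c a) b (br c a z x) y = 0
}.

Definition family_star prec succ (a b : Omega) (x y : A) : A :=
  succ a x y + prec b x y.

Definition family_bracket prec succ (a b : Omega) (x y : A) : A :=
  family_star prec succ a b x y - family_star prec succ b a y x.

End FamilyAlgebras.

(* Main.v *)
(** Splitting the associator of the star product into three parts, the first
    pre-anti-flexible identity makes one part symmetric under the exchange of
    (x,a) and (z,c), while the second one identifies each of the other two with
    the exchanged version of the other.  Hence the associator of the star
    product is symmetric in its outer arguments, and the Jacobi sum of the
    commutator, being the alternating sum of the associators, vanishes. *)
Require Import Defs.
From mathcomp Require Import all_boot all_algebra.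

Import GRing.Theory.

Local Open Scope ring_scope.

(** Bilinearity is available as a bare predicate on partial maps; this extracts from it the sum and
    difference rules needed to expand nested products. *)
Lemma additive_of_linear (K : pzRingType) (U V : lmodType K) (f : U -> V) :
  linear f -> {morph f : u v / u + v} /\ {morph f : u v / u - v}.
Proof.
move=> linf; split=> u v; first by have := linf 1 u v; rewrite !scale1r.
by rewrite addrC -scaleN1r linf scaleN1r addrC.
Qed.

(* The product p_uvw stands for (uv)w and q_uvw for u(vw). *)
Lemma alternating_associators_eq0 (V : zmodType)
    (p_xyz p_yzx p_zxy p_zyx p_xzy p_yxz : V)
    (q_xyz q_yzx q_zxy q_zyx q_xzy q_yxz : V) :
  p_xyz - q_xyz = p_zyx - q_zyx -> p_yzx - q_yzx = p_xzy - q_xzy ->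
  p_zxy - q_zxy = p_yxz - q_yxz ->
  (p_xyz - p_yxz - (q_zxy - q_zyx)) + (p_yzx - p_zyx - (q_xyz - q_xzy))
  + (p_zxy - p_xzy - (q_yzx - q_yxz)) = 0.
Proof.
move=> Hxyz Hyzx Hzxy; rewrite !opprB !addrA.
(* Each associator is placed beside the negative of the one with its outer arguments exchanged, so
   that the hypotheses cancel the terms in fours. *)
rewrite [LHS](ACl (((1*8)*(3*6))*((5*12)*(7*10))*((9*4)*(11*2)))) /=.
by rewrite Hxyz Hyzx Hzxy !subrKA !subrr !addr0.
Qed.

Section FamilyBracket.

Variables (Omega : Type) (mul : SemiGroup.com_law Omega).
Variables (K : fieldType) (A : lmodType K) (prec succ : Omega -> A -> A -> A).
Hypothesis paf : pre_anti_flexible_family_algebra mul prec succ.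

Let star := family_star prec succ.

Lemma family_star_bilinear a b : bilinear_for *:%R *:%R (star a b).
Proof.
have [pl pr] := paf_bilinear_prec paf b.
have [sl sr] := paf_bilinear_succ paf a.
split=> u k v w; rewrite /star /family_star.
  have /= -> := pl u k v w; have /= -> := sl u k v w.
  by rewrite scalerDr addrACA.
have /= -> := pr u k v w; have /= -> := sr u k v w.
by rewrite scalerDr addrACA.
Qed.

Lemma family_starBl a b z : {morph (star a b)^~ z : x y / x - y}.
Proof. by have [/(_ z)/additive_of_linear[]] := family_star_bilinear a b. Qed.

Lemma family_starBr a b x : {morph star a b x : y z / y - z}.
Proof. by have [_ /(_ x)/additive_of_linear[]] := family_star_bilinear a b. Qed.

Lemma family_bracket_bilinear a b :
  bilinear_for *:%R *:%R (family_bracket prec succ a b).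
Proof.
have [l1 r1] := family_star_bilinear a b.
have [l2 r2] := family_star_bilinear b a.
split=> u k v w; rewrite /family_bracket -/star.
  have /= -> := l1 u k v w; have /= -> := r2 u k v w.
  by rewrite scalerBr opprD addrACA.
have /= -> := r1 u k v w; have /= -> := l2 u k v w.
by rewrite scalerBr opprD addrACA.
Qed.

(** The indices [mul c b] and [mul b a] stand in the order produced by the axioms; commutativity of
    [mul] is not yet applied. *)
Lemma family_star_anti_flexible x y z a b c :
  star (mul a b) c (star a b x y) z - star a (mul b c) x (star b c y z)
  = star (mul c b) a (star c b z y) x - star c (mul b a) z (star b a y x).
Proof.
(* The summands are, in order, the left side of [paf_succ_succ] at [u v w d e], its right side at
   [w v u f e], and the left side of [paf_succ_prec] at [u v w d f]. *)
have star_assocE u v w d e f :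
    star (mul d e) f (star d e u v) w - star d (mul e f) u (star e f v w)
    = (succ (mul d e) (succ d u v + prec e u v) w - succ d u (succ e v w))
      + (prec f (prec e u v) w - prec (mul e f) u (succ e v w + prec f v w))
      + (prec f (succ d u v) w - succ d u (prec f v w)).
  have [/(_ w)/additive_of_linear[pD _] _] := paf_bilinear_prec paf f.
  have [_ /(_ u)/additive_of_linear[sD _]] := paf_bilinear_succ paf d.
  rewrite /star /family_star /= in pD sD *.
  by rewrite pD sD !opprD !addrA [LHS](ACl (1*4*3*6*2*5)).
rewrite !star_assocE (paf_succ_prec paf x y z a c).
(* The first summand on the right becomes the second on the left; the next rewrite does the
   converse, leaving only a swap. *)
have := paf_succ_succ paf z y x c b; rewrite -/star => ->.
by rewrite (paf_succ_succ paf) [X in X + _ = _]addrC.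
Qed.

Lemma family_bracket_Jacobi x y z a b c :
  let br := family_bracket prec succ in
  br (mul a b) c (br a b x y) z
  + br (mul b c) a (br b c y z) x
  + br (mul c a) b (br c a z x) y = 0.
Proof.
rewrite /= /family_bracket -/star !family_starBl !family_starBr.
have Hxyz := family_star_anti_flexible x y z a b c.
have Hyzx := family_star_anti_flexible y z x b c a.
have Hzxy := family_star_anti_flexible z x y c a b.
(* Commutativity aligns the indices of the exchanged associators with [mul a b], [mul b c] and
   [mul c a] from the Jacobi sum. *)
rewrite (SemiGroup.mulmC _ c b) (SemiGroup.mulmC _ b a) in Hxyz.
rewrite (SemiGroup.mulmC _ a c) (SemiGroup.mulmC _ c b) in Hyzx.
rewrite (SemiGroup.mulmC _ b a) (SemiGroup.mulmC _ a c) in Hzxy.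
exact: alternating_associators_eq0 Hxyz Hyzx Hzxy.
Qed.

End FamilyBracket.

Theorem theorem2p10 (Omega : Type) (mul : SemiGroup.com_law Omega)
  (K : fieldType) (charK : [pchar K] =i pred0) (A : vectType K)
  (prec succ : Omega -> A -> A -> A)
  (paf : pre_anti_flexible_family_algebra mul prec succ) :
  relative_Lie_algebra mul (family_bracket prec succ).
Proof.
split=> [a b | x y a b | x y z a b c].
- exact: family_bracket_bilinear paf a b.
- by rewrite /family_bracket addrC subrKA subrr.
- exact: family_bracket_Jacobi paf x y z a b c.
Qed.
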